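(* The angular halfspace depth is upper semi-continuous as a function of $(x,P) \in \mathbb S^{d-1} \times \mathcal P(\mathbb S^{d-1})$, meaning that $$\limsup_{n\to\infty} \mathrm{ahD}(x_n;P_n) \le \mathrm{ahD}(x;P)$$ whenever $x_n \to x$ in $\mathbb S^{d-1}$ and $P_n \xrightarrow{w} P$ in $\mathcal P(\mathbb S^{d-1})$ as $n\to\infty$. In particular, for every $P \in \mathcal P(\mathbb S^{d-1})$ the function $x \mapsto \mathrm{ahD}(x;P)$ is upper semi-continuous on $\mathbb S^{d-1}$. If, in addition, $P$ is smooth in the sense that $$P(\partial H) = 0 \text{ for all } H \in \mathcal H_0,$$ then $$\lim_{n\to\infty} \mathrm{ahD}(x_n;P_n) = \mathrm{ahD}(x;P)$$ whenever $x_n \to x$ in $\mathbb S^{d-1}$ and $P_n \xrightarrow{w} P$ in $\mathcal P(\mathbb S^{d-1})$ as $n\to\infty$.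
   Context: Let $d \ge 2$ be an integer, $\mathbb S^{d-1} = \{x \in \mathbb R^d : \|x\| = 1\}$, and let $\mathcal P(\mathbb S^{d-1})$ be the set of Borel probability measures on $\mathbb S^{d-1}$; $P_n \xrightarrow{w} P$ denotes weak convergence of measures. For a Borel set $A \subseteq \mathbb R^d$ and $P \in \mathcal P(\mathbb S^{d-1})$, write $P(A) = P(A \cap \mathbb S^{d-1})$. For $u \in \mathbb S^{d-1}$ let $H_{0,u} = \{y \in \mathbb R^d : \langle y,u\rangle \ge 0\}$ and $\mathcal H_0 = \{H_{0,u} : u \in \mathbb S^{d-1}\}$; $\partial H$ is the topological boundary of $H$. The angular halfspace depth is $$\mathrm{ahD}(x;P) = \inf\{P(H_{0,u}) : u \in \mathbb S^{d-1},\ x \in H_{0,u}\},\qquad x \in \mathbb S^{d-1}.$$ *)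

(* Defs.v *)
From HB Require Import structures.
From mathcomp Require Import all_boot all_order all_algebra.
From mathcomp Require Import all_classical all_reals all_analysis.

Set Implicit Arguments.
Unset Strict Implicit.
Unset Printing Implicit Defensive.

Import Order.TTheory GRing.Theory Num.Theory.
Import numFieldNormedType.Exports.

Local Open Scope classical_set_scope.
Local Open Scope ring_scope.

Definition dotv (R : realType) (m : nat) (x y : 'rV[R]_m) : R :=
  \sum_(i < m) x ord0 i * y ord0 i.

(* The library norm `|x| of a row vector is the sup norm, so the Euclidean
   norm is defined here; both induce the library topology of 'rV[R]_m. *)
Definition enorm (R : realType) (m : nat) (x : 'rV[R]_m) : R :=
  Num.sqrt (dotv x x).

Definition sphere_set (R : realType) (n : nat) : set 'rV[R]_n.+1 :=
  [set x | enorm x = 1].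
Arguments sphere_set : clear implicits.

(* sphere R n is S^n in R^(n+1), hence S^(d-1) in R^d is sphere R d.-1 for
   d > 0.  The index is shifted because measurable types must be inhabited. *)
Definition sphere (R : realType) (n : nat) : Type :=
  set_type (sphere_set R n).

HB.instance Definition _ (R : realType) (n : nat) :=
  Choice.copy (sphere R n) (set_type (sphere_set R n)).
HB.instance Definition _ (R : realType) (n : nat) :=
  PseudoMetric.copy (sphere R n) (set_type (sphere_set R n)).

Lemma sphere_set_delta (R : realType) (n : nat) :
  delta_mx 0 0 \in sphere_set R n.
Proof.
rewrite inE /sphere_set /= /enorm /dotv (bigD1 ord0) //= big1 ?addr0.
  by rewrite !mxE /= mulr1 sqrtr1.
by move=> i /negPf i0; rewrite !mxE i0 mulr0.
Qed.

HB.instance Definition _ (R : realType) (n : nat) :=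
  isPointed.Build (sphere R n) (SigSub (sphere_set_delta R n)).

(* Borel sigma-algebra of the subspace topology *)
HB.instance Definition _ (R : realType) (n : nat) :=
  Measurable.copy (sphere R n)
    (g_sigma_algebraType (@open (sphere R n))).

Definition sphere_val (R : realType) (n : nat) (x : sphere R n) :
  'rV[R]_n.+1 := set_val x.
Arguments sphere_val : clear implicits.
Coercion sphere_val : sphere >-> matrix.

Notation sphere_probability R n := (probability (sphere R n) R).

(* P(A) = P(A `&` S^n) for A a subset of the ambient space *)
Definition ambient (R : realType) (n : nat) (P : sphere_probability R n)
  (A : set 'rV[R]_n.+1) : \bar R := P (sphere_val R n @^-1` A).

Definition weak_cvg (R : realType) (n : nat)
  (P_ : nat -> sphere_probability R n) (P : sphere_probability R n) : Prop :=
  forall f : sphere R n -> R, continuous f -> bounded_fun f ->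
    (\int[P_ k]_y (f y)%:E)%E @[k --> \oo] --> (\int[P]_y (f y)%:E)%E.

Definition halfspace0 (R : realType) (n : nat) (u : sphere R n) :
  set 'rV[R]_n.+1 := [set y | 0 <= dotv y u].

Definition halfspaces0 (R : realType) (n : nat) : set (set 'rV[R]_n.+1) :=
  [set halfspace0 u | u in [set: sphere R n]].
Arguments halfspaces0 : clear implicits.

Definition boundary (T : topologicalType) (A : set T) : set T :=
  closure A `\` A^°.

Definition ahD (R : realType) (n : nat) (x : sphere R n)
  (P : sphere_probability R n) : \bar R :=
  ereal_inf [set ambient P (halfspace0 u) |
             u in [set u : sphere R n | halfspace0 u x]].

Definition smooth (R : realType) (n : nat) (P : sphere_probability R n) :
  Prop := forall H, halfspaces0 R n H -> ambient P (boundary H) = 0%E.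

(* counterpart of the library's lower_semicontinuous *)
Definition upper_semicontinuous (X : topologicalType) (R : numFieldType)
  (f : X -> \bar R) : Prop :=
  forall x a, (f x < a%:E)%E ->
    exists2 V, nbhs x V & forall y, V y -> (f y < a%:E)%E.

(* Main.v *)
Require Import Defs.
From mathcomp Require Import all_boot all_order all_algebra.
From mathcomp Require Import all_classical all_reals all_analysis.
From mathcomp Require Import lra.

Import Order.TTheory GRing.Theory Num.Theory.
Import numFieldNormedType.Exports measurable_realfun.

Local Open Scope classical_set_scope.
Local Open Scope ring_scope.

(** Points x_i -> x and measures P_i -> P are taken along an arbitrary filter F:
the filter of sequences gives the statements on limits, and the filter of
neighbourhoods of x, with a constant family of measures, gives the
semicontinuity of the depth of a fixed P.

The halfspaces through the origin H_u = {y | 0 <= <y, u>} are parametrized by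
their normals, and everything rests on one joint estimate: P(H_u) is upper semicontinuous in the
pair (u, P) (lemma [probability_cap_lt]).  If P(H_u) < a then, since H_u is the
decreasing intersection of the caps <y, u> >= - e, already some such cap has
P-measure below a.  A continuous ramp squeezed between the caps at levels
- e / 2 and - e has P-integral below a, and by weak convergence the same holds
for the measures near P.  For v close to u the halfspace H_v meets the sphere
inside the cap <y, u> >= - e / 2, so these measures give H_v mass below a.
Taking complements and opposite normals, the measure of the open halfspace is
lower semicontinuous in (u, P) (lemma [probability_open_cap_gt]).

Upper semicontinuity of the depth (lemma [ahD_lt_near]): let H_u contain x and nearly realize the
depth of x.  The point x_i may lie outside H_u, but adding to u the multiple
|<x_i, u>| - <x_i, u> of x_i gives a vector w_i with <x_i, w_i> >= 0; it tends
to u because <x, u> >= 0, so that P_i(H_(w_i)) is eventually small.  Normals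
need not have norm one, because positive scaling preserves the halfspace.

Lower semicontinuity when P is smooth (lemma [ahD_ge_near]): open and closed halfspaces have the same
P-measure, so every u with <x, u> >= 0 has an open halfspace of P-measure above
any a < ahD(x; P), and this persists for (v, i) near (u, F).  Those u with
<x, u> < 0 still satisfy <x_i, v> < 0 for (v, i) near (u, F).  By compactness
of the sphere, in its near-covering form, one set of F serves all
normals at once, which bounds the infimum defining ahD(x_i; P_i) from below. *)

Section angular_halfspace_depth.
Set Implicit Arguments.
Unset Strict Implicit.
Unset Printing Implicit Defensive.
Context {R : realType} {n : nat}.
Implicit Types (x u v w : 'rV[R]_n.+1).

(** * Inner product and sphere *)

Lemma dotvC x (y : 'rV[R]_n.+1) : dotv x y = dotv y x.
Proof. by apply: eq_bigr => i _; rewrite mulrC. Qed.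

Lemma dotvDr x v w : dotv x (v + w) = dotv x v + dotv x w.
Proof. by rewrite -big_split; apply: eq_bigr => i _; rewrite mxE mulrDr. Qed.

Lemma dotvZr (c : R) x w : dotv x (c *: w) = c * dotv x w.
Proof. by rewrite mulr_sumr; apply: eq_bigr => i _; rewrite mxE mulrCA. Qed.

Lemma dotvNr x w : dotv x (- w) = - dotv x w.
Proof. by rewrite -scaleN1r dotvZr mulN1r. Qed.

Lemma dotvv_ge0 x : 0 <= dotv x x.
Proof. by apply: sumr_ge0 => i _; rewrite -expr2 sqr_ge0. Qed.

Lemma dotvv_eq0 x : (dotv x x == 0) = (x == 0).
Proof.
apply/idP/eqP => [|->]; last first.
  by rewrite /dotv big1// => i _; rewrite mxE mul0r.
rewrite psumr_eq0 => [/allP x0|i _]; last by rewrite -expr2 sqr_ge0.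
apply/rowP => i; rewrite mxE.
by have /eqP/eqP := x0 i (mem_index_enum i); rewrite mulf_eq0 orbb => /eqP.
Qed.

Lemma cvg_dotv (T : Type) (F : set_system T) {FF : Filter F}
    (f g : T -> 'rV[R]_n.+1) u v :
  f @ F --> u -> g @ F --> v -> dotv (f t) (g t) @[t --> F] --> dotv u v.
Proof.
move=> fx gy; apply: cvg_big => [|i _]; first exact: add_continuous.
apply: cvgM.
- exact: (cvg_comp _ _ fx (@coord_continuous R _ _ _ _ u)).
- exact: (cvg_comp _ _ gy (@coord_continuous R _ _ _ _ v)).
Qed.

Lemma sphere_val_continuous : continuous (sphere_val R n).
Proof. exact: initial_continuous. Qed.

Lemma cvg_sphere_val (I : Type) (F : set_system I) {FF : Filter F}
    (x_ : I -> sphere R n) (x : sphere R n) :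
  x_ @ F --> x -> sphere_val R n (x_ i) @[i --> F] --> sphere_val R n x.
Proof.
by move=> xF; apply: (cvg_comp _ _ xF); exact: (@sphere_val_continuous x).
Qed.

Lemma sphere_setP v : sphere_set R n v <-> dotv v v = 1.
Proof.
split=> [/(congr1 (fun r => r ^+ 2))|vv].
  by rewrite sqr_sqrtr ?dotvv_ge0// expr1n.
by rewrite /sphere_set/= /enorm vv sqrtr1.
Qed.

Lemma sphere_in_set (y : sphere R n) : sphere_set R n y.
Proof. exact: set_mem (valP y). Qed.

Lemma dotvv_sphere (y : sphere R n) : dotv y y = 1.
Proof. exact/sphere_setP/sphere_in_set. Qed.

Lemma sphere_coord_le1 v i : sphere_set R n v -> `|v ord0 i| <= 1.
Proof.
move=> /sphere_setP; rewrite /dotv (bigD1 i)//= => v1.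
rewrite -(@ler_sqr R) ?nnegrE// expr1n real_normK ?num_real// -v1 expr2 lerDl.
by apply: sumr_ge0 => j _; rewrite -expr2 sqr_ge0.
Qed.

Lemma sphere_set_compact : compact (sphere_set R n).
Proof.
have cube : compact [set v : 'rV[R]_n.+1 | forall i, `[-1, 1]%classic (v ord0 i)].
  apply: (@rV_compact R n.+1 (fun=> `[-1, 1]%classic)) => i.
  exact: segment_compact.
apply: subclosed_compact cube _ => [|v sv i /=]; last first.
  by rewrite in_itv/= -ler_norml; exact: sphere_coord_le1.
have -> : sphere_set R n = (fun v => dotv v v) @^-1` [set 1].
  by apply/seteqP; split => v /sphere_setP.
apply: closed_comp => [v _|]; last exact: closed_eq.
exact: (@cvg_dotv _ (nbhs v) _ id id v v).
Qed.

Lemma continuous_measurable_sphere (f : sphere R n -> R) :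
  continuous f -> measurable_fun setT f.
Proof.
move=> cf; apply: (measurability _ (RGenOInfty.measurableE R)) => //.
move=> _ [_ [a ->] <-]; rewrite setTI; apply: sub_sigma_algebra.
by move: cf => /continuousP; apply; exact: rray_open.
Qed.

(** * Spherical caps *)

(** Normals of any length are allowed, to spare the normalization of perturbed
ones; at level t = 0 only the direction of w matters. *)
Definition cap w (t : R) : set (sphere R n) := [set y | t <= dotv y w].

Definition open_cap w : set (sphere R n) := [set y | 0 < dotv y w].

Lemma continuous_dotv_sphere w : continuous (fun y : sphere R n => dotv y w).
Proof.
move=> y; apply: (@cvg_dotv _ (nbhs y) _ (sphere_val R n) (cst w)).
  exact: (@sphere_val_continuous y).
exact: cvg_cst.
Qed.

Lemma measurable_cap w t : measurable (cap w t).
Proof.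
have := continuous_measurable_sphere (@continuous_dotv_sphere w) measurableT
  (measurable_itv `[t, +oo[).
rewrite setTI; congr measurable; apply/seteqP; split => y;
  by rewrite /cap/= in_itv/= andbT.
Qed.

Lemma open_capE v : open_cap v = ~` cap (- v) 0.
Proof.
apply/seteqP; split => y; rewrite /open_cap /cap/= dotvNr oppr_ge0.
  by rewrite ltNge => /negP.
by move/negP; rewrite -ltNge.
Qed.

Lemma measurable_open_cap w : measurable (open_cap w).
Proof. by rewrite open_capE; apply: measurableC; exact: measurable_cap. Qed.

Lemma dotv_sphere_le (y : sphere R n) w : `|dotv y w| <= n.+1%:R * `|w|.
Proof.
apply: (le_trans (ler_norm_sum _ _ _)).
have -> : n.+1%:R * `|w| = \sum_(i < n.+1) 1 * `|w|.
  by rewrite sumr_const card_ord mul1r mulr_natl.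
apply: ler_sum => i _.
rewrite normrM; apply: ler_pM => //.
  exact/sphere_coord_le1/sphere_in_set.
by rewrite -[leRHS]/(mx_norm w) mx_normrE; exact: (le_bigmax _ _ (ord0, i)).
Qed.

(** This holds because y |-> <y, u - v> is small uniformly on the sphere when v
is close to u. *)
Lemma cap_near u (e : R) : 0 < e ->
  \forall v \near u, cap v 0 `<=` cap u (- e).
Proof.
move=> e0.
(* each of the n + 1 coordinates contributes at most the sup norm of u - v *)
have en0 : 0 < e / n.+1%:R by rewrite divr_gt0.
have := @cvgr_dist_lt _ _ _ _ (nbhs_filter u) id u cvg_id _ en0.
apply: filterS => v /= uve y; rewrite /cap/= => vy.
have := dotv_sphere_le y (u - v).
move: uve; rewrite ltr_pdivlMr// mulrC dotvDr dotvNr => uve duv.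
have := le_lt_trans duv uve; rewrite ltr_norml => /andP[+ _].
by lra.
Qed.

(** * Weak convergence and halfspaces *)

(** A continuous bounded function between the indicators of two half-lines, to
test weak convergence against: it is 0 up to - 2 e and 1 from - e on. *)
Definition ramp (e t : R) : R := Num.max 0 (Num.min 1 (2 + t / e)).

Lemma ramp_ge0 e t : 0 <= ramp e t.
Proof. by rewrite /ramp le_max lexx. Qed.

Lemma ramp_le1 e t : ramp e t <= 1.
Proof. by rewrite /ramp ge_max ler01 ge_min lexx. Qed.

Lemma ramp_eq1 e t : 0 < e -> - e <= t -> ramp e t = 1.
Proof.
move=> e0 et; rewrite /ramp; have : -1 <= t / e by rewrite ler_pdivlMr// mulN1r.
move=> te; rewrite min_l ?max_r//; lra.
Qed.

Lemma ramp_eq0 e t : 0 < e -> t <= - (2 * e) -> ramp e t = 0.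
Proof.
move=> e0 et; rewrite /ramp; have : t / e <= - 2 by rewrite ler_pdivrMr// mulNr.
move=> te; rewrite max_l// ge_min; apply/orP; right; lra.
Qed.

Lemma continuous_ramp e : continuous (ramp e).
Proof.
apply: (@max_fun_continuous _ R R (cst 0)); first exact: cst_continuous.
apply: (@min_fun_continuous _ R R (cst 1)); first exact: cst_continuous.
move=> t; apply: cvgD; first exact: cvg_cst.
by apply: cvgM; [exact: cvg_id|exact: cvg_cst].
Qed.

(** Weak convergence along any filter, so that a constant measure with a point
moving in a neighbourhood filter is also covered. *)
Definition weak_cvg_along (I : Type) (F : set_system I)
    (P_ : I -> sphere_probability R n) (P : sphere_probability R n) : Prop :=
  forall f : sphere R n -> R, continuous f -> bounded_fun f ->
    (\int[P_ i]_y (f y)%:E)%E @[i --> F] --> (\int[P]_y (f y)%:E)%E.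

(** Continuity of P along the caps that decrease to a closed halfspace. *)
Lemma cap_right_continuous (P : sphere_probability R n) u (a : \bar R) :
  (P (cap u 0) < a)%E -> exists2 e : R, 0 < e & (P (cap u (- e)) < a)%E.
Proof.
move=> Pa; pose E k := cap u (- k.+1%:R^-1).
have capE : \bigcap_k E k = cap u 0.
  apply/seteqP; split => y /= => [yE|y0 k _]; last first.
    by apply: le_trans y0; rewrite oppr_le0.
  rewrite /cap/=; apply/ler_addgt0Pr => e e0.
  have [k] := ltr_add_invr e0; rewrite add0r => ke.
  rewrite -lerBlDr sub0r; apply: le_trans (yE k I).
  by rewrite lerN2 ltW.
have Pcvg : P (E k) @[k --> \oo] --> P (cap u 0).
  rewrite -capE; apply: nonincreasing_cvg_mu.
  - by rewrite ltey_eq fin_num_measure//; exact: measurable_cap.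
  - by move=> k; exact: measurable_cap.
  - by rewrite capE; exact: measurable_cap.
  - move=> k l kl; rewrite subsetEset => y; apply: le_trans.
    by rewrite lerN2 lef_pV2 ?posrE// ler_nat.
have [k _ /(_ k (leqnn k)) PEk] := Pcvg _ (open_ereal_lt' Pa).
by exists k.+1%:R^-1.
Qed.

Lemma open_nbhs_ereal_lt (I : Type) (F : set_system I) (f : I -> \bar R) l a :
  f @ F --> l -> (l < a)%E -> \forall i \near F, (f i < a)%E.
Proof. by move=> fl la; exact: (fl _ (open_ereal_lt' la)). Qed.

(** Joint upper semicontinuity of the measure of a closed halfspace: the
portmanteau argument with a ramp, where the room left by the ramp also absorbs
a small rotation of the normal. *)
Lemma probability_cap_lt (I : Type) (F : set_system I) {FF : Filter F}
    (P_ : I -> sphere_probability R n) (P : sphere_probability R n)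
    u (a : \bar R) :
  weak_cvg_along F P_ P -> (P (cap u 0) < a)%E ->
  \forall v \near u & i \near F, (P_ i (cap v 0) < a)%E.
Proof.
move=> PF /cap_right_continuous[e e0 Pa].
pose f (y : sphere R n) := ramp (e / 2) (dotv y u).
have e20 : 0 < e / 2 by rewrite divr_gt0.
have cf : continuous f.
  move=> y; apply: (@continuous_comp _ _ _ (fun y : sphere R n => dotv y u)).
    exact: continuous_dotv_sphere.
  exact: continuous_ramp.
have mf : measurable_fun setT (fun y : sphere R n => (f y)%:E).
  by apply/measurable_EFinP; exact: continuous_measurable_sphere.
have bf : bounded_fun f.
  exists 1; split=> // M M1 y _.
  by rewrite /= ger0_norm ?ramp_ge0// (le_trans (ramp_le1 _ _))// ltW.
have mindic v t :
    measurable_fun setT (fun y : sphere R n => (\1_(cap v t) y)%:E).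
  by apply/measurable_EFinP; apply: measurable_indic; exact: measurable_cap.
have fP : (\int[P]_y (f y)%:E < a)%E.
  apply: le_lt_trans Pa; rewrite -[cap u (- e)]setIT -integral_indic//; last first.
    exact: measurable_cap.
  apply: ge0_le_integral => //= [y _|y _]; rewrite lee_fin ?ramp_ge0//.
  rewrite indicE; case: (boolP (y \in cap u (- e))) => [_|/negP ny].
    exact: ramp_le1.
  rewrite /f ramp_eq0//; move/negP: ny; rewrite notin_setE /cap/= => /negP.
  by rewrite -ltNge; lra.
exists ([set v | cap v 0 `<=` cap u (- (e / 2))],
        [set i | (\int[P_ i]_y (f y)%:E < a)%E]).
  split; first exact: cap_near.
  exact: open_nbhs_ereal_lt (PF f cf bf) fP.
move=> [v i] [/= vu]; apply: le_lt_trans.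
rewrite -[cap v 0]setIT -integral_indic//; last exact: measurable_cap.
apply: ge0_le_integral => //= y _; rewrite lee_fin indicE.
case: (boolP (y \in cap v 0)) => [/set_mem/vu yu|_]; last exact: ramp_ge0.
by rewrite /f ramp_eq1//; exact: yu.
Qed.

(** An open halfspace is the complement of the closed one with opposite normal,
so this is the previous estimate at - u and 1 - a. *)
Lemma probability_open_cap_gt (I : Type) (F : set_system I) {FF : Filter F}
    (P_ : I -> sphere_probability R n) (P : sphere_probability R n) u (a : R) :
  weak_cvg_along F P_ P -> (a%:E < P (open_cap u))%E ->
  \forall v \near u & i \near F, (a%:E < P_ i (open_cap v))%E.
Proof.
have lt1 (Q : sphere_probability R n) w :
    (a%:E < Q (open_cap w))%E = (Q (cap (- w) 0) < (1 - a)%:E)%E.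
  rewrite open_capE probability_setC; last exact: measurable_cap.
  rewrite -[Q _](fineK (fin_num_measure _ _ (measurable_cap _ _))) -EFinB !lte_fin.
  by rewrite ltrBrDr ltrBrDl addrC.
rewrite lt1 => PF /(probability_cap_lt PF) uF.
have : \forall v \near (- u) & i \near F, (P_ i (cap v 0) < (1 - a)%:E)%E := uF.
move=> [[V W] [/= Vu FW] VW]; exists ((fun v => V (- v)), W) => /=.
  by split=> //; exact: (@oppr_continuous _ _ u).
by move=> [v i] [/= Vv Wi]; rewrite lt1; exact: (VW (- v, i)).
Qed.

(** * Semicontinuity of the depth *)

Lemma ahD_le (x : sphere R n) (P : sphere_probability R n) w :
  w != 0 -> 0 <= dotv x w -> (ahD x P <= P (cap w 0))%E.
Proof.
move=> w0 xw; pose c := enorm w.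
have c0 : 0 < c by rewrite sqrtr_gt0 lt_def dotvv_eq0 w0 dotvv_ge0.
have uS : sphere_set R n (c^-1 *: w).
  apply/sphere_setP; rewrite dotvZr dotvC dotvZr mulrA -invfM -expr2.
  by rewrite sqr_sqrtr ?dotvv_ge0// mulVf// dotvv_eq0.
pose u : sphere R n := SigSub (mem_set uS).
have uw (y : 'rV[R]_n.+1) : (0 <= dotv y u) = (0 <= dotv y w).
  by rewrite [dotv y u]dotvZr pmulr_rge0 ?invr_gt0.
apply: ereal_inf_lbound; exists u; first by rewrite /halfspace0/= uw.
by congr (P _); apply/seteqP; split => y; rewrite /halfspace0 /cap/= uw.
Qed.

(** A halfspace nearly realizing the depth of x is tilted so that it contains
x_i. *)
Lemma ahD_lt_near (I : Type) (F : set_system I) {FF : Filter F}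
    (x_ : I -> sphere R n) (x : sphere R n)
    (P_ : I -> sphere_probability R n) (P : sphere_probability R n) (a : \bar R) :
  x_ @ F --> x -> weak_cvg_along F P_ P -> (ahD x P < a)%E ->
  \forall i \near F, (ahD (x_ i) (P_ i) < a)%E.
Proof.
move=> xF PF /ereal_inf_lt[_ [u /= xu <-]] Pua.
have [[V W] [/= Vu FW] VW] := probability_cap_lt PF Pua.
(* as x_i is a unit vector, <x_i, w_i> = |<x_i, u>|; the coefficient of x_i
   tends to 0 because 0 <= <x, u> *)
pose w i : 'rV[R]_n.+1 :=
  (`|dotv (x_ i) u| - dotv (x_ i) u) *: sphere_val R n (x_ i) + u.
have xvF : sphere_val R n (x_ i) @[i --> F] --> sphere_val R n x.
  exact: cvg_sphere_val.
have wF : w @ F --> (u : 'rV[R]_n.+1).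
  have xuF : dotv (x_ i) u @[i --> F] --> dotv x u.
    by apply: cvg_dotv => //; exact: cvg_cst.
  have -> : (u : 'rV[R]_n.+1) = (`|dotv x u| - dotv x u) *: sphere_val R n x + u.
    by rewrite ger0_norm// subrr scale0r add0r.
  apply: cvgD; last exact: cvg_cst.
  by apply: cvgZ => //; apply: cvgB => //; exact: cvg_norm.
have w_neq0 : \forall i \near F, dotv (w i) (w i) > 0.
  have : dotv (w i) (w i) @[i --> F] --> dotv u u by exact: cvg_dotv.
  by move=> /cvgr_gt; apply; rewrite dotvv_sphere.
near=> i.
have wi0 : w i != 0 by rewrite -dotvv_eq0 gt_eqF//; near: i.
apply: (le_lt_trans (ahD_le _ wi0 _)).
  by rewrite dotvDr dotvZr dotvv_sphere mulr1 subrK.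
by apply: (VW (w i, i)); split; near: i => //; exact: wF.
Unshelve. all: by end_near. Qed.

(** A point y with <y, u> = 0 is not interior, since y - t u leaves the
halfspace for every t > 0. *)
Lemma boundary_halfspace0 (u : sphere R n) :
  boundary (halfspace0 u) = [set y | dotv y u = 0].
Proof.
have cdot : continuous (fun y : 'rV[R]_n.+1 => dotv y u).
  by move=> y; apply: (@cvg_dotv _ (nbhs y) _ id (cst _)) => //; exact: cvg_cst.
apply/seteqP; split => y.
  have hcl : closed (halfspace0 u).
    by apply: (closed_comp _ (@closed_ge R 0)) => ? _; exact: cdot.
  rewrite /boundary -(closure_id _).1// => -[].
  move=> y0 ny; apply/eqP; rewrite eq_le y0 andbT leNgt; apply/negP => y_gt0.
  apply: ny; have := @cvgr_gt _ _ _ (nbhs_filter y) _ _ (cdot y) _ y_gt0.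
  by apply: filterS => z /ltW.
move=> /= yu; split; first by apply: subset_closure; rewrite /halfspace0/= yu.
move=> /= ny.
have yt : (y - t *: (u : 'rV[R]_n.+1)) @[t --> 0^'+] --> y.
  rewrite -[X in _ --> X]subr0 -(scale0r (u : 'rV[R]_n.+1)).
  apply: cvgB; first exact: cvg_cst.
  by apply: cvgZr_tmp; exact: cvg_at_right_filter cvg_id.
have := yt _ ny; rewrite near_simpl => yt0.
have : \forall t \near (0 : R)^'+, False.
  near=> t.
  have : 0 <= dotv (y - t *: (u : 'rV[R]_n.+1)) u by near: t; exact: yt0.
  apply/negP; rewrite -ltNge dotvC dotvDr dotvNr dotvZr (dotvC u y) yu add0r.
  by rewrite dotvv_sphere mulr1 oppr_lt0; near: t; exact: nbhs_right_gt.
by move=> /filter_ex[].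
Unshelve. all: by end_near. Qed.

Lemma smooth_open_cap (P : sphere_probability R n) (u : sphere R n) :
  smooth P -> P (cap u 0) = P (open_cap u).
Proof.
move=> /(_ _ (imageT (@halfspace0 R n) u)); rewrite boundary_halfspace0 => P0.
have <- : sphere_val R n @^-1` [set y | dotv y u = 0] `|`
    (open_cap u) = cap u 0.
  apply/seteqP; split => y; rewrite /open_cap /cap/= le_eqVlt.
    by move=> [->|->]; rewrite ?eqxx ?orbT.
  by move=> /orP[/eqP|]; [left|right].
have mZ : measurable (sphere_val R n @^-1` [set y | dotv y u = 0]).
  have -> : sphere_val R n @^-1` [set y | dotv y u = 0] =
      cap u 0 `&` cap (- (u : 'rV__)) 0.
    apply/seteqP; split => y; rewrite /cap/= dotvNr oppr_ge0; first by move=> ->.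
    by move=> [y0 y1]; apply/eqP; rewrite eq_le y0 y1.
  by apply: measurableI; exact: measurable_cap.
rewrite measureU//.
- by rewrite -[RHS]add0e; congr (_ + _)%E; exact: P0.
- exact: measurable_open_cap.
- by apply/seteqP; split => // y [/= y0]; rewrite /open_cap/= y0 ltxx.
Qed.

Lemma ahD_fin_num (x : sphere R n) (P : sphere_probability R n) :
  ahD x P \is a fin_num.
Proof.
rewrite ge0_fin_numE; last by apply: le_ereal_inf_tmp => _ [u _ <-].
have x0 : (x : 'rV[R]_n.+1) != 0 by rewrite -dotvv_eq0 dotvv_sphere oner_eq0.
apply: (le_lt_trans (ahD_le P x0 _)); first by rewrite dotvv_sphere.
by apply: (le_lt_trans (probability_le1 _ _)); [exact: measurable_cap|exact: ltry].
Qed.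

(** Each normal v has a neighbourhood, and a set of F, on which either x_i is
outside H_v or P_i(H_v) > a; compactness of the sphere makes the set of F
independent of v. *)
Lemma ahD_ge_near (I : Type) (F : set_system I) {FF : Filter F}
    (x_ : I -> sphere R n) (x : sphere R n)
    (P_ : I -> sphere_probability R n) (P : sphere_probability R n) (a : R) :
  smooth P -> x_ @ F --> x -> weak_cvg_along F P_ P -> (a%:E < ahD x P)%E ->
  \forall i \near F, (a%:E <= ahD (x_ i) (P_ i))%E.
Proof.
move=> sP xF PF aP.
have xvF : sphere_val R n (x_ i) @[i --> F] --> sphere_val R n x.
  exact: cvg_sphere_val.
pose Q i v := 0 <= dotv (x_ i) v -> (a%:E < P_ i (cap v 0))%E.
have : \forall i \near F, sphere_set R n `<=` Q i.
  apply: (compact_near_coveringP _).1 => [|v vS]; first exact: sphere_set_compact.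
  have [xv|xv] := leP 0 (dotv x v).
    have v0 : v != 0.
      by rewrite -dotvv_eq0 (sphere_setP _).1// oner_eq0.
    pose u : sphere R n := SigSub (mem_set vS).
    have aPv : (a%:E < P (open_cap v))%E.
      rewrite -(smooth_open_cap u sP); apply: (lt_le_trans aP).
      exact: ahD_le.
    have [VW VWv VWP] := probability_open_cap_gt PF aPv.
    exists VW => // -[w i] /VWP /= lt_a _; apply: (lt_le_trans lt_a).
    apply: le_measure; rewrite ?inE; last by move=> y /ltW.
      exact: measurable_open_cap.
    exact: measurable_cap.
  have : \forall p \near filter_prod (nbhs v) F, dotv (x_ p.2) p.1 < 0.
    have : dotv (x_ p.2) p.1 @[p --> filter_prod (nbhs v) F] --> dotv x v.
      apply: cvg_dotv; last exact: cvg_fst.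
      by apply: (cvg_comp snd (sphere_val R n \o x_)); [exact: cvg_snd|exact: xvF].
    by move=> /cvgr_lt; exact.
  by apply: filterS => -[w i] /=; rewrite /Q ltNge => /negP.
apply: filterS => i QS; apply: le_ereal_inf_tmp => _ [u xu <-].
by apply/ltW/QS => //; exact: sphere_in_set.
Qed.

End angular_halfspace_depth.

Theorem theorem3 (R : realType) (d : nat) (d_ge2 : (2 <= d)%N) :
  (forall (x_ : nat -> sphere R d.-1) (x : sphere R d.-1)
      (P_ : nat -> sphere_probability R d.-1) (P : sphere_probability R d.-1),
    x_ k @[k --> \oo] --> x -> weak_cvg P_ P ->
    (limn_esup (fun k => ahD (x_ k) (P_ k)) <= ahD x P)%E) /\
  (forall P : sphere_probability R d.-1,
    upper_semicontinuous (fun x : sphere R d.-1 => ahD x P)) /\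
  (forall P : sphere_probability R d.-1, smooth P ->
    forall (x_ : nat -> sphere R d.-1) (x : sphere R d.-1)
      (P_ : nat -> sphere_probability R d.-1),
    x_ k @[k --> \oo] --> x -> weak_cvg P_ P ->
    ahD (x_ k) (P_ k) @[k --> \oo] --> ahD x P).
Proof.
split; [|split].
- move=> x_ x P_ P x_x PP; apply/lee_addgt0Pr => e e0.
  have : (ahD x P < ahD x P + e%:E)%E by rewrite lteDl ?ahD_fin_num// lte_fin.
  move=> /(ahD_lt_near x_x PP) near_lt.
  pose K := [set k | (ahD (x_ k) (P_ k) < ahD x P + e%:E)%E].
  apply: (@le_trans _ _ (ereal_sup [set ahD (x_ k) (P_ k) | k in K])).
    by apply: ereal_inf_lbound; eexists; [exact: near_lt|].
  by apply: ge_ereal_sup => _ [k /ltW ? <-].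
- move=> P x a xa.
  exists [set y | (ahD y P < a%:E)%E] => //.
  have cP : weak_cvg_along (nbhs x) (fun=> P) P by move=> f _ _; exact: cvg_cst.
  exact: (ahD_lt_near (@cvg_id _ (nbhs x)) cP xa).
- move=> P sP x_ x P_ x_x PP.
  rewrite -(fineK (ahD_fin_num x P)).
  under eq_fun do rewrite -(fineK (ahD_fin_num _ _)).
  apply: cvg_EFin; first by near=> k.
  apply/cvgrPdist_le => e e0; rewrite /=.
  have lo : ((fine (ahD x P) - e)%:E < ahD x P)%E.
    by rewrite -[ltRHS](fineK (ahD_fin_num x P)) lte_fin ltrBlDr ltrDl.
  have hi : (ahD x P < (fine (ahD x P) + e)%:E)%E.
    by rewrite -[ltLHS](fineK (ahD_fin_num x P)) lte_fin ltrDl.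
  have lt_hi := ahD_lt_near x_x PP hi.
  have ge_lo := ahD_ge_near sP x_x PP lo.
  near=> k; have : (ahD (x_ k) (P_ k) < (fine (ahD x P) + e)%:E)%E
    by near: k; exact: lt_hi.
  have : ((fine (ahD x P) - e)%:E <= ahD (x_ k) (P_ k))%E
    by near: k; exact: ge_lo.
  rewrite -[ahD (x_ k) _](fineK (ahD_fin_num _ _)) lee_fin lte_fin => klo khi.
  by rewrite ler_norml; lra.
Unshelve. all: by end_near. Qed.
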